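(* Let $\lambda,\mu,\theta,\Delta>0$ and $\rho:=\lambda/\mu$. The second-order Taylor approximation of the amplitude (defined in the context) is $$\frac{\rho}{2}-L^*,$$ where $$L^*=-\frac{1+e^{-\mu\Delta}+\rho f'(0)(1-e^{-\mu\Delta})}{\rho f''(0)(1-e^{-\mu\Delta})}\pm\frac{\sqrt{\left(1+e^{-\mu\Delta}+\rho f'(0)(1-e^{-\mu\Delta})\right)^2-2\rho^2 f''(0)(1-e^{-\mu\Delta})\left(f(0)(1-e^{-\mu\Delta})-1\right)}}{\rho f''(0)(1-e^{-\mu\Delta})}$$ and $$f(0)=\frac{1}{1+e^{-\theta\rho}},\qquad f'(0)=-\frac{\theta}{2}\,\mathrm{sech}^2\left(-\frac{\rho\theta}{2}\right),\qquad f''(0)=\theta^2\tanh\left(-\frac{\theta\rho}{2}\right)\mathrm{sech}^2\left(-\frac{\theta\rho}{2}\right).$$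
   Context: Consider the two-queue updating system $\dot q_i(t)=\lambda\,\frac{\exp(-\theta q_i(\Phi(t,\Delta)))}{\sum_{j=1}^2\exp(-\theta q_j(\Phi(t,\Delta)))}-\mu q_i(t)$, $i=1,2$, with $\Phi(t,\Delta)=\lfloor t/\Delta\rfloor\Delta$. The amplitude of its steady-state oscillations is $\frac{\rho}{2}-L$, where $L$ solves the fixed-point equation $\rho-L=Le^{-\mu\Delta}+\rho f(L)(1-e^{-\mu\Delta})$ with the multinomial logit function $f(x)=\frac{e^{-\theta x}}{e^{-\theta x}+e^{-\theta(\rho-x)}}=\frac{1}{1+e^{-\theta(\rho-2x)}}$; $f(0),f'(0),f''(0)$ denote the values of this function and its derivatives at $0$. A second-order Taylor approximation of the amplitude is a number $\frac{\rho}{2}-L^*$, where $L^*$ is a solution of the quadratic equation obtained by replacing $f(L)$ in the fixed-point equation by its second-order Taylor polynomial at $0$: $\rho-L^*=L^*e^{-\mu\Delta}+\rho\left(f(0)+f'(0)L^*+\tfrac{1}{2}f''(0)(L^* )^2\right)(1-e^{-\mu\Delta})$. The sign $\pm$ indicates the two roots of this quadratic (understood over $\mathbb{C}$ should the quantity under the square root be negative). *)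

(* Defs.v *)
From Stdlib Require Export Reals.
From Coquelicot Require Export Coquelicot.
Open Scope R_scope.

Definition sech (x : R) : R := / cosh x.

(** Multinomial logit: probability of joining a queue of (delayed) length [x]
    when the other queue has length [rho - x]. *)
Definition logit (theta rho x : R) : R :=
  exp (- theta * x) / (exp (- theta * x) + exp (- theta * (rho - x))).

(** The fixed-point equation
    [rho - L = L e^(-mu Delta) + rho f(L) (1 - e^(-mu Delta))]
    satisfied by [L] when the amplitude of the steady-state oscillations is
    [rho/2 - L].  The argument [fL] stands for the value [f(L)], so that the
    exact equation is the case [fL = logit theta rho L], and approximations of
    [f] can be substituted.  It is stated over [C] because the Taylor-truncated
    equation may have no real root. *)
Definition fixed_point_equation (rho mu Delta : R) (fL L : C) : Prop :=
  let E : C := RtoC (exp (- (mu * Delta))) in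
  (RtoC rho - L = L * E + RtoC rho * fL * (1 - E))%C.

Definition taylor2_at0 (f : R -> R) (x : C) : C :=
  (RtoC (f 0%R) + RtoC (Derive_n f 1 0%R) * x
   + RtoC (/ 2 * Derive_n f 2 0%R)%R * (x * x))%C.

Definition is_taylor2_amplitude (rho mu theta Delta : R) (A : C) : Prop :=
  exists L : C,
    fixed_point_equation rho mu Delta (taylor2_at0 (logit theta rho) L) L /\
    A = (RtoC (rho / 2)%R - L)%C.

(** Principal complex square root of a real number, possibly negative. *)
Definition csqrt (x : R) : C :=
  if Rle_dec 0 x then RtoC (sqrt x) else (Ci * RtoC (sqrt (- x)))%C.

(* Main.v *)
Require Import Defs.
From Stdlib Require Import Lra.

(** The logit is a rescaled hyperbolic tangent,
    [f x = (1 - tanh (theta * (x - rho / 2))) / 2]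
    ([logit_tanh]), so its derivatives follow from [tanh' = sech ^ 2] and
    [(sech ^ 2)' = - 2 * tanh * sech ^ 2]; at [x = 0] the argument of [tanh] is
    [- theta * rho / 2], which is where the arguments in the closed forms come
    from.

    With these Taylor coefficients, collecting powers of [L] turns the truncated
    fixed-point equation into [d / 2 * L ^ 2 + b * L + c = 0], where
    [c = rho * (f(0) * (1 - E) - 1)].  It is a genuine quadratic: [E < 1]
    since [mu * Delta > 0], and [f''(0) < 0] since [tanh] is negative at
    [- theta * rho / 2 < 0], hence [d <> 0].  Its discriminant
    [b ^ 2 - 2 * d * c] is [D], and completing the square in [C]
    ([C_quadratic_roots]) yields exactly the two roots, whatever the sign
    of [D]. *)

(** * Hyperbolic functions *)

Lemma cosh_pos (x : R) : 0 < cosh x.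
Proof.
  unfold cosh; generalize (exp_pos x) (exp_pos (- x)); lra.
Qed.

Lemma cosh2_minus_sinh2 (x : R) : cosh x ^ 2 - sinh x ^ 2 = 1.
Proof.
  unfold cosh, sinh.
  assert (H : exp x * exp (- x) = 1)
    by (rewrite <- exp_plus, Rplus_opp_r; apply exp_0).
  nra.
Qed.

Lemma is_derive_cosh (x : R) : is_derive cosh x (sinh x).
Proof. apply is_derive_Reals, derivable_pt_lim_cosh. Qed.

Lemma is_derive_sinh (x : R) : is_derive sinh x (cosh x).
Proof. apply is_derive_Reals, derivable_pt_lim_sinh. Qed.

Lemma is_derive_tanh (x : R) : is_derive tanh x (sech x ^ 2).
Proof.
  assert (Hc := Rgt_not_eq _ _ (cosh_pos x)).
  replace (sech x ^ 2) with ((cosh x * cosh x - sinh x * sinh x) / cosh x ^ 2).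
  - apply (is_derive_div sinh cosh).
    + apply is_derive_sinh.
    + apply is_derive_cosh.
    + exact Hc.
  - replace (cosh x * cosh x - sinh x * sinh x) with 1
      by (rewrite <- (cosh2_minus_sinh2 x); ring).
    unfold sech; field; exact Hc.
Qed.

Lemma is_derive_sech (x : R) : is_derive sech x (- (tanh x * sech x)).
Proof.
  assert (Hc := Rgt_not_eq _ _ (cosh_pos x)).
  replace (- (tanh x * sech x)) with (- sinh x / cosh x ^ 2)
    by (unfold tanh, sech; field; exact Hc).
  apply (is_derive_inv cosh); [apply is_derive_cosh | exact Hc].
Qed.

Lemma is_derive_sech2 (x : R) :
  is_derive (fun y => sech y ^ 2) x (- 2 * tanh x * sech x ^ 2).
Proof.
  replace (- 2 * tanh x * sech x ^ 2)
    with (INR 2 * (- (tanh x * sech x)) * sech x ^ pred 2) by (simpl; ring).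
  apply is_derive_pow, is_derive_sech.
Qed.

Lemma tanh_neg (x : R) : x < 0 -> tanh x < 0.
Proof.
  intros Hx; unfold tanh.
  apply Rdiv_neg_pos; [| apply cosh_pos].
  unfold sinh; assert (exp x < exp (- x)) by (apply exp_increasing; lra); lra.
Qed.

(** * Derivatives of the logit function *)

(** Dividing numerator and denominator by [exp (- theta * rho / 2)] leaves
    [exp (- y) / (exp (- y) + exp y)] with [y := theta * (x - rho / 2)]. *)
Lemma logit_tanh (theta rho x : R) :
  logit theta rho x = (1 - tanh (theta * (x - rho / 2))) / 2.
Proof.
  unfold logit, tanh, sinh, cosh.
  set (y := theta * (x - rho / 2)).
  replace (- theta * x) with (- (theta * rho / 2) + - y)
    by (unfold y; field).
  replace (- theta * (rho - x)) with (- (theta * rho / 2) + y)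
    by (unfold y; field).
  rewrite !exp_plus.
  generalize (exp_pos (- (theta * rho / 2))) (exp_pos y) (exp_pos (- y)).
  intros; field; repeat split; nra.
Qed.

Lemma logit_0 (theta rho : R) :
  logit theta rho 0 = 1 / (1 + exp (- (theta * rho))).
Proof.
  unfold logit.
  replace (- theta * 0) with 0 by ring.
  replace (- theta * (rho - 0)) with (- (theta * rho)) by ring.
  now rewrite exp_0.
Qed.

Lemma is_derive_logit (theta rho x : R) :
  is_derive (logit theta rho) x
    (- (theta / 2) * sech (theta * (x - rho / 2)) ^ 2).
Proof.
  apply (is_derive_ext (fun y => (1 - tanh (theta * (y - rho / 2))) / 2)).
  { intros y; symmetry; apply logit_tanh. }
  auto_derive.
  - eexists; apply is_derive_tanh.
  - rewrite (is_derive_unique _ _ _ (is_derive_tanh _)).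
    unfold Rminus; field.
Qed.

Lemma is_derive_Derive_logit (theta rho x : R) :
  is_derive (Derive (logit theta rho)) x
    (theta ^ 2 * tanh (theta * (x - rho / 2))
     * sech (theta * (x - rho / 2)) ^ 2).
Proof.
  apply (is_derive_ext
           (fun y => - (theta / 2) * (fun z => sech z ^ 2) (theta * (y - rho / 2)))).
  { intros y; symmetry; apply is_derive_unique, is_derive_logit. }
  replace (theta ^ 2 * tanh (theta * (x - rho / 2))
           * sech (theta * (x - rho / 2)) ^ 2)
    with (- (theta / 2) * (theta * (- 2 * tanh (theta * (x - rho / 2))
                                   * sech (theta * (x - rho / 2)) ^ 2))) by field.
  apply is_derive_scal.
  apply (is_derive_comp (fun z => sech z ^ 2)).
  - apply is_derive_sech2.
  - auto_derive; [exact I | ring].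
Qed.

(** * Complex quadratic equations *)

Lemma Cmult_eq_0 (z w : C) : (z * w = 0)%C -> z = 0%C \/ w = 0%C.
Proof.
  intros H.
  destruct (Ceq_dec z 0) as [Hz | Hz]; [now left |].
  destruct (Ceq_dec w 0) as [Hw | Hw]; [now right |].
  destruct (Cmult_neq_0 z w Hz Hw H).
Qed.

Lemma csqrt_sqr (x : R) : (csqrt x * csqrt x)%C = RtoC x.
Proof.
  unfold csqrt; destruct (Rle_dec 0 x) as [Hx | Hx].
  - now rewrite <- RtoC_mult, sqrt_sqrt.
  - assert (H : sqrt (- x) * sqrt (- x) = - x) by (apply sqrt_sqrt; lra).
    apply injective_projections; simpl; lra.
Qed.

(** Completing the square: [2 * d] times the left-hand side equals
    [(d * z + b) ^ 2 - s ^ 2], which splits into linear factors.  The leading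
    coefficient is written [d / 2], as for a second-order Taylor polynomial,
    so that the roots have denominator [d]. *)
Lemma C_quadratic_roots (d b c s z : C) :
  d <> 0%C -> (s * s = b * b - 2 * d * c)%C ->
  (d / 2 * (z * z) + b * z + c = 0)%C <->
  z = (- (b / d) + s / d)%C \/ z = (- (b / d) - s / d)%C.
Proof.
  intros Hd Hs.
  assert (H2 : (2 : C) <> 0%C) by (intros H; apply RtoC_inj in H; lra).
  assert (Hsq : ((d * z + b - s) * (d * z + b + s)
                 = 2 * d * (d / 2 * (z * z) + b * z + c))%C).
  { transitivity ((d * z + b) * (d * z + b) - s * s)%C; [ring |].
    rewrite Hs; field; exact H2. }
  split.
  - intros Hz; rewrite Hz, Cmult_0_r in Hsq.
    destruct (Cmult_eq_0 _ _ Hsq) as [H | H]; [left | right].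
    + replace z with ((d * z + b - s - b + s) / d)%C by (field; exact Hd).
      rewrite H; field; exact Hd.
    + replace z with ((d * z + b + s - b - s) / d)%C by (field; exact Hd).
      rewrite H; field; exact Hd.
  - intros Hz.
    assert (H0 : (2 * d * (d / 2 * (z * z) + b * z + c) = 0)%C).
    { rewrite <- Hsq; destruct Hz as [-> | ->]; field; exact Hd. }
    destruct (Cmult_eq_0 _ _ H0) as [H | H]; [| exact H].
    destruct (Cmult_neq_0 _ _ H2 Hd H).
Qed.

(** * The Taylor approximation of the amplitude *)

Theorem theorem2p4 :
  forall lambda mu theta Delta : R,
    0 < lambda -> 0 < mu -> 0 < theta -> 0 < Delta ->
    let rho := lambda / mu in
    let f := logit theta rho in
    let f0 := 1 / (1 + exp (- (theta * rho))) in
    let f1 := - (theta / 2) * sech (- (rho * theta / 2)) ^ 2 in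
    let f2 := theta ^ 2 * tanh (- (theta * rho / 2))
              * sech (- (theta * rho / 2)) ^ 2 in
    let E := exp (- (mu * Delta)) in
    let b := 1 + E + rho * f1 * (1 - E) in
    let D := b ^ 2 - 2 * rho ^ 2 * f2 * (1 - E) * (f0 * (1 - E) - 1) in
    let d := rho * f2 * (1 - E) in
    let Lplus := (- (RtoC b / RtoC d) + csqrt D / RtoC d)%C in
    let Lminus := (- (RtoC b / RtoC d) - csqrt D / RtoC d)%C in
    f 0 = f0 /\
    is_derive_n f 1 0 f1 /\
    is_derive_n f 2 0 f2 /\
    (forall A : C,
       is_taylor2_amplitude rho mu theta Delta A <->
       A = (RtoC (rho / 2) - Lplus)%C \/ A = (RtoC (rho / 2) - Lminus)%C).
Proof.
  intros lambda mu theta Delta Hlambda Hmu Htheta HDelta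
    rho f f0 f1 f2 E b D d Lplus Lminus.
  assert (Hrho : 0 < rho) by (apply Rdiv_lt_0_compat; assumption).
  assert (Hf0 : f 0 = f0) by apply logit_0.
  assert (Hf1 : is_derive_n f 1 0 f1).
  { unfold f1; replace (- (rho * theta / 2)) with (theta * (0 - rho / 2)) by field.
    apply is_derive_logit. }
  assert (Hf2 : is_derive_n f 2 0 f2).
  { unfold f2; replace (- (theta * rho / 2)) with (theta * (0 - rho / 2)) by field.
    apply is_derive_Derive_logit. }
  do 3 (split; [assumption |]).
  assert (Hf2_neg : f2 < 0).
  { assert (Ht : tanh (- (theta * rho / 2)) < 0) by (apply tanh_neg; nra).
    assert (Hs : 0 < sech (- (theta * rho / 2)) ^ 2)
      by (apply pow_lt, Rinv_0_lt_compat, cosh_pos).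
    assert (Ht2 : 0 < theta ^ 2) by (apply pow_lt; assumption).
    unfold f2; apply Rmult_neg_pos; [apply Rmult_pos_neg |]; assumption. }
  assert (HE : E < 1).
  { unfold E; rewrite <- exp_0; apply exp_increasing; nra. }
  assert (Hd : RtoC d <> 0%C).
  { intros H; apply RtoC_inj in H; unfold d in H.
    assert (0 < rho * (1 - E)) by (apply Rmult_lt_0_compat; lra).
    nra. }
  set (c := rho * (f0 * (1 - E) - 1)).
  assert (Hroots : forall L : C,
    fixed_point_equation rho mu Delta (taylor2_at0 f L) L <->
    L = Lplus \/ L = Lminus).
  { intros L.
    assert (Hdisc : (csqrt D * csqrt D
                     = RtoC b * RtoC b - 2 * RtoC d * RtoC c)%C).
    { rewrite csqrt_sqr, <- !RtoC_mult, <- RtoC_minus.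
      f_equal; unfold D, d, c; ring. }
    unfold Lplus, Lminus; rewrite <- (C_quadratic_roots _ _ _ _ _ Hd Hdisc).
    unfold fixed_point_equation, taylor2_at0.
    rewrite Hf0, (is_derive_n_unique _ _ _ _ Hf1), (is_derive_n_unique _ _ _ _ Hf2).
    fold E.
    assert (Hdiff :
      (RtoC d / 2 * (L * L) + RtoC b * L + RtoC c
       = (L * E + rho * (f0 + f1 * L + RtoC (/ 2 * f2)%R * (L * L)) * (1 - E))
         - (rho - L))%C).
    { unfold d, b, c.
      repeat rewrite ?RtoC_mult, ?RtoC_plus, ?RtoC_minus.
      rewrite RtoC_inv by lra.
      field; intros H; apply RtoC_inj in H; lra. }
    rewrite Hdiff; split; intros H.
    - rewrite H; ring.
    - rewrite <- (Cplus_0_r (rho - L)%C), <- H; ring. }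
  intros A; split.
  - intros [L [HL ->]].
    destruct (proj1 (Hroots L) HL) as [-> | ->]; [now left | now right].
  - intros [-> | ->]; eexists; (split; [apply Hroots | reflexivity]);
      [now left | now right].
Qed.
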